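(* Let $f:\mathbb{R}\to\mathbb{R}$ satisfy assumptions (A1) and (A2) below, and consider the Cauchy problem $\dot x=f(x)$, $x(0)=x_0$. Then: (i) for every $x_0\in\mathbb{R}$ there exists at least one Carathéodory solution, defined for all times $t\geq 0$; (ii) every Carathéodory solution is monotone (either nondecreasing or nonincreasing); (iii) for each $x_0$, the set of all Carathéodory solutions is nonempty and closed with respect to the topology of uniform convergence on bounded subsets of $[0,+\infty[$.
   Context: (A1): $f$ is bounded and regulated, i.e. it admits left and right limits $f(x-)$, $f(x+)$ at every point $x\in\mathbb{R}$. (A2): if $y$ is a point where either $f(y-)\cdot f(y+)=0$ or $f(y-)>0>f(y+)$, then $f(y)=0$. A Carathéodory solution of the Cauchy problem $\dot x=f(x)$, $x(0)=x_0$ is a function $t\mapsto x(t)$ on $[0,+\infty[$ (or on an interval $[0,\tau]$ when stated) satisfying $x(t)=x_0+\int_0^t f(x(s))\,ds$ for all $t$ in its domain. *)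

(* Defs.v *)
From HB Require Import structures.
From mathcomp Require Import all_boot all_order all_algebra.
From mathcomp Require Import all_classical all_reals all_analysis.
Set Implicit Arguments. Unset Strict Implicit. Unset Printing Implicit Defensive.
Import Order.TTheory GRing.Theory Num.Theory.
Import numFieldNormedType.Exports.
Local Open Scope classical_set_scope.
Local Open Scope ring_scope.

Definition bounded_fun (R : realType) (f : R -> R) : Prop :=
  exists M : R, forall x, `|f x| <= M.

Definition regulated (R : realType) (f : R -> R) : Prop :=
  forall x : R, cvg (f z @[z --> x^'-]) /\ cvg (f z @[z --> x^'+]).

Definition lim_left (R : realType) (f : R -> R) (y : R) : R := lim (f z @[z --> y^'-]).
Definition lim_right (R : realType) (f : R -> R) (y : R) : R := lim (f z @[z --> y^'+]).

Definition A1 (R : realType) (f : R -> R) : Prop := bounded_fun f /\ regulated f.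

Definition A2 (R : realType) (f : R -> R) : Prop :=
  forall y : R,
    (lim_left f y * lim_right f y = 0 \/ (0 < lim_left f y /\ lim_right f y < 0)) ->
    f y = 0.

(* Caratheodory solution of x' = f(x), x(0) = x0 on [0,+oo[ : for every t >= 0,
   s |-> f (x s) is Lebesgue integrable on [0,t] and
   x t = x0 + \int_0^t f (x s) ds.  Values of x at negative times are irrelevant. *)
Definition caratheodory_solution (R : realType) (f : R -> R) (x0 : R) (x : R -> R) : Prop :=
  forall t : R, 0 <= t ->
    (@lebesgue_measure R).-integrable `[0, t] (fun s => (f (x s))%:E) /\
    x t = x0 + \int[@lebesgue_measure R]_(s in `[0, t]) f (x s).

Definition monotone_on_nonneg (R : realType) (x : R -> R) : Prop :=
  (forall s t, 0 <= s -> s <= t -> x s <= x t) \/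
  (forall s t, 0 <= s -> s <= t -> x t <= x s).

(* F converges to x in the topology of uniform convergence on bounded subsets of
   [0,+oo[ (every bounded subset of [0,+oo[ is contained in some [0,T]). *)
Definition cvg_unif_bounded (R : realType) (F : set_system (R -> R)) (x : R -> R) : Prop :=
  forall T eps : R, 0 < eps ->
    F [set y | forall t, 0 <= t <= T -> `|y t - x t| < eps].

(* Main.v *)
Require Import Defs.
From HB Require Import structures.
From mathcomp Require Import all_boot all_order all_algebra.
From mathcomp Require Import all_classical all_reals all_analysis.
From mathcomp Require Import measurable_realfun lra.
Set Implicit Arguments.
Unset Strict Implicit.
Unset Printing Implicit Defensive.
Import Order.TTheory GRing.Theory Num.Theory.
Import numFieldNormedType.Exports.
Local Open Scope classical_set_scope.
Local Open Scope ring_scope.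

(** A regulated function is almost constant on small one-sided punctured
    neighbourhoods, so interval induction (Cousin's lemma) replaces both
    compactness and a.e. differentiation: a path whose one-sided increments
    locally match the one-sided limits of [f \o x] is a solution, and conversely
    bounds on [f \o x] bound the increments of a solution.

    Monotonicity: a solution that goes up and later down through a range of
    values forces [f (p+) = 0] for each value [p] in that range, hence [f = 0]
    there by (A2), and a solution cannot cross an interval where [f = 0].

    Closedness: let nondecreasing solutions converge to [x]. On a stretch where
    [x] has the constant value [p], (A2) gives [f p = 0], since otherwise [f] would
    be bounded away from [0] on both sides of [p] and the approximating solutions
    would leave [p] at positive speed. Off such stretches the slope of [x] is read
    off from the one-sided limits of [f].

    Existence: if [f x0 <> 0], then up to reflection [f (x0+) > 0]. The solution is
    the inverse of the travel time [T z = \int_x0^z 1 / f] up to the first point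
    where a one-sided limit of [f] fails to be positive; by (A2) [f] vanishes at
    that point, and the solution stays there. *)

(** * Interval induction and integrability of regulated functions *)

(** Take the supremum of the points [q] with [P a q]. The condition on the left of a point puts the
    supremum itself in this set, and the condition on the right pushes beyond it unless it is
    [b]. *)
Lemma cousin (R : realType) (P : R -> R -> Prop) (a b : R) :
  (forall p q r, a <= p -> p < q -> q < r -> r <= b -> P p q -> P q r -> P p r) ->
  (forall p, a <= p < b ->
     exists2 d, 0 < d & forall q, p < q < p + d -> q <= b -> P p q) ->
  (forall p, a < p <= b ->
     exists2 d, 0 < d & forall q, p - d < q < p -> a <= q -> P q p) ->
  a < b -> P a b.
Proof.
move=> Ptr Pr Pl ab.
pose S := [set q | a < q <= b /\ P a q].
have Sub : ubound S b by move=> q [/andP[]].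
have [d d0 Pd] := Pr a (introT andP (conj (lexx a) ab)).
pose q0 := Num.min b (a + d / 2).
have q0a : a < q0 by rewrite /q0 lt_min; apply/andP; split; lra.
have q0b : q0 <= b by rewrite /q0 ge_min lexx.
have q0d : q0 <= a + d / 2 by rewrite /q0 ge_min lexx orbT.
have Sq0 : S q0 by split; [rewrite q0a|apply: Pd; [lra|]].
have hS : has_sup S by split; [exists q0|exists b].
have sb : sup S <= b by apply: ge_sup => //; exists q0.
have sa : a < sup S by apply: (lt_le_trans q0a); apply: ub_le_sup => //; exists b.
have [e e0 Pe] := Pl (sup S) (introT andP (conj sa sb)).
have Ps : P a (sup S).
  have [q Sq qs] := sup_adherent e0 hS.
  have qs' : q <= sup S by apply: ub_le_sup => //; exists b.
  move: Sq => [/andP[aq qb] Paq].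
  have [<-//|qns] := eqVneq q (sup S).
  have qlt : q < sup S by rewrite lt_neqAle qns.
  by apply: (Ptr a q _ (lexx a) aq qlt sb Paq); apply: Pe; lra.
have [<-//|snb] := eqVneq (sup S) b.
have slt : sup S < b by rewrite lt_neqAle snb.
have [k k0 Pk] := Pr (sup S) (introT andP (conj (ltW sa) slt)).
pose r := Num.min b (sup S + k / 2).
have rs : sup S < r by rewrite /r lt_min; apply/andP; split; lra.
have rb : r <= b by rewrite /r ge_min lexx.
have rk : r <= sup S + k / 2 by rewrite /r ge_min lexx orbT.
have : S r.
  split; first lra.
  by apply: (Ptr a (sup S) r (lexx a) sa rs rb Ps); apply: Pk; lra.
by move=> Sr; have := ub_le_sup (ex_intro _ b Sub) Sr; lra.
Qed.

(** One-sided limits in Cauchy form: [L] may depend on [e]. This is the form in which slopes of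
    paths deliver them, and the form that interval induction consumes. *)
Definition regulated_on (R : realType) (h : R -> R) (a b : R) : Prop :=
  (forall p e, a <= p < b -> 0 < e ->
     exists L, exists2 d, 0 < d & forall q, p < q < p + d -> `|h q - L| <= e) /\
  (forall p e, a < p <= b -> 0 < e ->
     exists L, exists2 d, 0 < d & forall q, p - d < q < p -> `|h q - L| <= e).

Lemma measurable_patch_lt (R : realType) (g1 g2 : R -> R) (c : R) :
  measurable_fun setT g1 -> measurable_fun setT g2 ->
  measurable_fun setT (fun x : R => if x < c then g1 x else g2 x).
Proof.
move=> m1 m2; apply: measurable_fun_ifT => //.
by apply: measurable_fun_ltr => //; exact: measurable_cst.
Qed.

(** Interval induction glues step functions. On a short interval beside [p] the step function is [L]
    inside and takes the exact values of [h] at the two ends, where the one-sided limit says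
    nothing. *)
Lemma regulated_on_approx (R : realType) (h : R -> R) (a b e : R) :
  regulated_on h a b -> 0 < e -> a < b ->
  exists g : R -> R, [/\ measurable_fun setT g,
    exists M, forall x, `|g x| <= M &
    forall x, a <= x <= b -> `|h x - g x| <= e].
Proof.
move=> [hr hl] e0.
pose P a b := exists g : R -> R, [/\ measurable_fun setT g,
  exists M, forall x, `|g x| <= M & forall x, a <= x <= b -> `|h x - g x| <= e].
apply: (@cousin R P).
- move=> p q r _ pq qr _ [g1 [m1 [M1 b1] c1]] [g2 [m2 [M2 b2] c2]].
  exists (fun x => if x < q then g1 x else g2 x); split.
  + exact: measurable_patch_lt.
  + exists (Num.max M1 M2) => x.
    by case: ifP => _; rewrite le_max ?b1 ?b2 ?orbT.
  + by move=> x xpr; case: ltP => xq; [apply: c1|apply: c2]; lra.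
- move=> p pab; have [L [d d0 Ld]] := hr p e pab e0.
  exists d => // q pqd _.
  exists (fun x => if x < q then (if p < x then L else h p) else h q).
  split.
  + apply: measurable_patch_lt => //.
    apply: measurable_fun_ifT => //.
    by apply: measurable_fun_ltr => //; exact: measurable_cst.
  + exists (Num.max `|h q| (Num.max `|h p| `|L|)) => x.
    by repeat case: ifP => _; rewrite !le_max lexx ?orbT.
  + move=> x xpq; case: ltP => xq; last first.
      by rewrite (_ : x = q) ?subrr ?normr0 1?ltW//; lra.
    case: ltP => px; first by apply: Ld; lra.
    by rewrite (_ : x = p) ?subrr ?normr0 1?ltW//; lra.
- move=> p pab; have [L [d d0 Ld]] := hl p e pab e0.
  exists d => // q pqd _.
  exists (fun x => if x < p then (if q < x then L else h q) else h p).
  split.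
  + apply: measurable_patch_lt => //.
    apply: measurable_fun_ifT => //.
    by apply: measurable_fun_ltr => //; exact: measurable_cst.
  + exists (Num.max `|h q| (Num.max `|h p| `|L|)) => x.
    by repeat case: ifP => _; rewrite !le_max lexx ?orbT.
  + move=> x xpq; case: ltP => xp; last first.
      by rewrite (_ : x = p) ?subrr ?normr0 1?ltW//; lra.
    case: ltP => px; first by apply: Ld; lra.
    by rewrite (_ : x = q) ?subrr ?normr0 1?ltW//; lra.
Qed.

(** Measurability comes from a limit of step approximants with errors [1 / (n + 1)], boundedness
    from a single approximant with error [1]. *)
Lemma regulated_on_integrable (R : realType) (h : R -> R) (a b : R) :
  a < b -> regulated_on h a b ->
  (@lebesgue_measure R).-integrable `[a, b] (EFin \o h).
Proof.
move=> ab hreg; apply: measurable_bounded_integrable => //.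
- rewrite /= lebesgue_measure_itv/= lte_fin ab -EFinB; exact: ltry.
- have n0 n : 0 < n.+1%:R^-1 :> R by rewrite invr_gt0.
  have /choice[g gP] n := regulated_on_approx hreg (n0 n) ab.
  apply: (@measurable_fun_cvg _ _ _ _ g) => [m|x /=].
    by have [mg _ _] := gP m; exact: measurable_funTS.
  rewrite in_itv/= => xab; apply/cvgrPdist_le => e e0.
  near=> n; have [_ _ /(_ x xab) hg] := gP n.
  apply: (le_trans hg); apply: ltW.
  by near: n; exact: (near_infty_natSinv_lt (PosNum e0)).
- have [g [_ [M gM] hg]] := regulated_on_approx hreg ltr01 ab.
  exists (M + 1); split; first exact: num_real.
  move=> y yM x /=; rewrite in_itv/= => xab.
  apply: le_trans (ltW yM).
  rewrite -[h x](subrK (g x)) addrC; apply: le_trans (ler_normD _ _) _.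
  by apply: lerD; [exact: gM|exact: hg].
Unshelve. all: by end_near. Qed.

(** The endpoints form a null set, so bounds on the open interval suffice. This matters because
    one-sided limits control [h] only on punctured neighbourhoods. *)
Lemma Rintegral_itv_increment_bounds (R : realType) (h : R -> R)
    (a b s t l u : R) :
  (@lebesgue_measure R).-integrable `[a, b] (EFin \o h) ->
  a <= s -> s <= t -> t <= b -> (forall r, s < r < t -> l <= h r <= u) ->
  l * (t - s) <= \int[@lebesgue_measure R]_(r in `[a, t]) h r -
                 \int[@lebesgue_measure R]_(r in `[a, s]) h r <= u * (t - s).
Proof.
move=> ih as_ st tb hlu.
have isub (i : interval R) : [set` i] `<=` `[a, b] ->
    (@lebesgue_measure R).-integrable [set` i] (EFin \o h).
  move=> iab; refine (@integrableS _ _ R (@lebesgue_measure R)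
    `[a, b] [set` i] (EFin \o h) _ _ iab ih); exact: measurable_itv.
have iat : (@lebesgue_measure R).-integrable `[a, t] (EFin \o h).
  by apply: isub => x/=; rewrite !in_itv/=; lra.
have ist : (@lebesgue_measure R).-integrable `]s, t[ (EFin \o h).
  by apply: isub => x/=; rewrite !in_itv/=; lra.
rewrite Rintegral_itvB// ?bnd_simp//.
rewrite -Rintegral_itv_bndo_bndc//.
have lst : fine (@lebesgue_measure R `]s, t[) = t - s.
  rewrite lebesgue_measure_itv/= lte_fin; case: ltP => // ts; rewrite /=; lra.
have icst c : (@lebesgue_measure R).-integrable `]s, t[ (EFin \o cst c).
  apply: measurable_bounded_integrable => //.
  - rewrite /= lebesgue_measure_itv/= lte_fin; case: ifP => _; last exact: ltry.
    by rewrite -EFinB; exact: ltry.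
  - exact: bounded_cst.
have cstE c : c * (t - s) = \int[@lebesgue_measure R]_(r in `]s, t[) c.
  by rewrite Rintegral_cst// lst.
rewrite !cstE; apply/andP; split.
  apply: le_Rintegral => //; first exact: icst.
  by move=> x /=; rewrite in_itv/= => /hlu/andP[].
apply: le_Rintegral => //; first exact: icst.
by move=> x /=; rewrite in_itv/= => /hlu/andP[].
Qed.

(** * Paths with prescribed one-sided slopes *)

(** The same [L] serves, up to [e], as one-sided limit of [h] and as one-sided slope of [x]: this
    replaces differentiability of [x] with derivative [h]. *)
Definition local_slopes (R : realType) (x h : R -> R) (a b : R) : Prop :=
  (forall p e, a <= p < b -> 0 < e ->
     exists L, exists2 d, 0 < d & forall q, p < q < p + d ->
       `|h q - L| <= e /\ `|x q - x p - L * (q - p)| <= e * (q - p)) /\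
  (forall p e, a < p <= b -> 0 < e ->
     exists L, exists2 d, 0 < d & forall q, p - d < q < p ->
       `|h q - L| <= e /\ `|x p - x q - L * (p - q)| <= e * (p - q)).

Lemma local_slopes_regulated_on (R : realType) (x h : R -> R) (a b : R) :
  local_slopes x h a b -> regulated_on h a b.
Proof.
move=> [sr sl]; split=> p e pab e0.
  by have [L [d d0 H]] := sr p e pab e0; exists L, d => // q /H[].
by have [L [d d0 H]] := sl p e pab e0; exists L, d => // q /H[].
Qed.

Lemma eq_of_dist_le (R : realType) (u v c : R) :
  (forall e, 0 < e -> `|u - v| <= e * c) -> u = v.
Proof.
move=> H; apply/eqP; rewrite -subr_eq0 -normr_le0.
have c0 : 0 <= c by have := H 1 ltr01; rewrite mul1r; apply: le_trans.
apply/ler_addgt0Pr => e e0; rewrite add0r.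
have := H (e / (c + 1)); rewrite divr_gt0//; last lra.
move=> /(_ isT) /le_trans; apply.
rewrite mulrAC ler_pdivrMr; last lra.
rewrite ler_wpM2l//; lra.
Qed.

(** A fundamental theorem of calculus. Beside each point [x] and the indefinite integral [I] of [h]
    both have slope within [e] of the same [L], so their increments differ by at most [2 * e] times
    the length. This bound is additive, and interval induction carries it to [[a, b]]. *)
Lemma local_slopes_Rintegral (R : realType) (x h : R -> R) (a b : R) :
  a < b -> local_slopes x h a b ->
  x b = x a + \int[@lebesgue_measure R]_(r in `[a, b]) h r.
Proof.
move=> ab sl.
have ih := regulated_on_integrable ab (local_slopes_regulated_on sl).
pose I t := \int[@lebesgue_measure R]_(r in `[a, t]) h r.
have Ia : I a = 0 by rewrite /I set_itv1 Rintegral_set1.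
have Ibd s t l u : a <= s -> s <= t -> t <= b ->
    (forall r, s < r < t -> l <= h r <= u) ->
    l * (t - s) <= I t - I s <= u * (t - s).
  exact: Rintegral_itv_increment_bounds ih.
rewrite -/(I b); suff : x b - x a = I b - I a by rewrite Ia; lra.
apply: (@eq_of_dist_le R _ _ (b - a)) => e' e'0.
have [e e0 ->] : exists2 e, 0 < e & e' = 2 * e by exists (e' / 2); lra.
pose P s t := `|x t - x s - (I t - I s)| <= 2 * e * (t - s).
have [sr sl'] := sl.
apply: (@cousin R P a b) => //; rewrite /P.
- by move=> p q r _ _ _ _; rewrite !ler_norml; lra.
- move=> p pab; have [L [d d0 H]] := sr p e pab e0.
  exists d => // q pqd qb.
  have [_] := H q pqd.
  have := Ibd p q (L - e) (L + e).
  move=> /(_ ltac:(lra) ltac:(lra) qb) HI.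
  have {HI} : (L - e) * (q - p) <= I q - I p <= (L + e) * (q - p).
    apply: HI => r rpq; have [+ _] := H r ltac:(lra).
    by rewrite ler_norml; lra.
  rewrite !ler_norml; lra.
- move=> p pab; have [L [d d0 H]] := sl' p e pab e0.
  exists d => // q pqd qa.
  have [_] := H q pqd.
  have := Ibd q p (L - e) (L + e).
  move=> /(_ qa ltac:(lra) ltac:(lra)) HI.
  have {HI} : (L - e) * (p - q) <= I p - I q <= (L + e) * (p - q).
    apply: HI => r rpq; have [+ _] := H r ltac:(lra).
    by rewrite ler_norml; lra.
  rewrite !ler_norml; lra.
Qed.

(** * Solutions and their increments *)

Lemma solution_of_local_slopes (R : realType) (f : R -> R) (x0 : R) (x : R -> R) :
  x 0 = x0 -> (forall t, 0 < t -> local_slopes x (f \o x) 0 t) ->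
  caratheodory_solution f x0 x.
Proof.
move=> x00 sl t; rewrite le_eqVlt => /predU1P[<-|t0].
  split; last by rewrite set_itv1 Rintegral_set1 addr0.
  rewrite set_itv1; apply/integrableP; split; first exact: measurable_fun_set1.
  by rewrite integral_set1 ltry.
split; last by rewrite (local_slopes_Rintegral t0 (sl t t0)) x00.
exact: (regulated_on_integrable t0 (local_slopes_regulated_on (sl t t0))).
Qed.

Section solution.
Variables (R : realType) (f : R -> R) (x0 : R) (x : R -> R).
Hypothesis solx : caratheodory_solution f x0 x.

Lemma solution_init : x 0 = x0.
Proof. by have [_ ->] := solx (lexx 0); rewrite set_itv1 Rintegral_set1 addr0. Qed.

Lemma solution_increment s t l u : 0 <= s -> s <= t ->
  (forall r, s < r < t -> l <= f (x r) <= u) ->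
  l * (t - s) <= x t - x s <= u * (t - s).
Proof.
move=> s0 st H.
have t0 := le_trans s0 st.
have [_ ->] := solx s0; have [it ->] := solx t0.
by have := Rintegral_itv_increment_bounds it s0 st (lexx t) H; lra.
Qed.

Lemma solution_increment_near s t L e : 0 <= s -> s <= t ->
  (forall r, s < r < t -> `|f (x r) - L| <= e) ->
  `|x t - x s - L * (t - s)| <= e * (t - s).
Proof.
move=> s0 st H.
have := @solution_increment s t (L - e) (L + e) s0 st.
rewrite ler_norml => H'; suff : (L - e) * (t - s) <= x t - x s <= (L + e) * (t - s) by lra.
by apply: H' => r /H; rewrite ler_norml; lra.
Qed.

Lemma solution_lipschitz M s t : (forall y, `|f y| <= M) ->
  0 <= s -> s <= t -> `|x t - x s| <= M * (t - s).
Proof.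
move=> fM s0 st; have := @solution_increment_near s t 0 M s0 st.
by rewrite mul0r subr0; apply => r _; rewrite subr0.
Qed.

End solution.

(** * One-sided limits of the field, and reflection *)

Lemma lim_right_close (R : realType) (f : R -> R) (p e : R) :
  regulated f -> 0 < e ->
  exists2 d, 0 < d & forall q, p < q < p + d -> `|f q - lim_right f p| <= e.
Proof.
move=> /(_ p)[_ /cvgrPdist_le /(_ e) H] /H; rewrite near_withinE.
move=> /nbhs_ballP[d /= d0 Hd]; exists d => // q pqd.
rewrite distrC; apply: Hd; last by lra.
by rewrite /ball/= ltr_norml; lra.
Qed.

Lemma lim_left_close (R : realType) (f : R -> R) (p e : R) :
  regulated f -> 0 < e ->
  exists2 d, 0 < d & forall q, p - d < q < p -> `|f q - lim_left f p| <= e.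
Proof.
move=> /(_ p)[/cvgrPdist_le /(_ e) H _] /H; rewrite near_withinE.
move=> /nbhs_ballP[d /= d0 Hd]; exists d => // q pqd.
rewrite distrC; apply: Hd; last by lra.
by rewrite /ball/= ltr_norml; lra.
Qed.

(** Conjugation by [y |-> - y]. It preserves (A1) and (A2) and negates solutions, so each argument
    is made for one direction of motion only. *)
Definition reflect_field (R : realType) (f : R -> R) : R -> R := fun y => - f (- y).

Lemma reflect_fieldK (R : realType) (f : R -> R) :
  reflect_field (reflect_field f) = f.
Proof. by apply/funext => y; rewrite /reflect_field !opprK. Qed.

Lemma cvg_reflect_left (R : realType) (f : R -> R) (y : R) : regulated f ->
  reflect_field f z @[z --> y^'-] --> - lim_right f (- y).
Proof.
move=> /(_ (- y))[_ cr]; apply: cvgN.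
by have /cvg_at_rightNP := cr; rewrite opprK.
Qed.

Lemma cvg_reflect_right (R : realType) (f : R -> R) (y : R) : regulated f ->
  reflect_field f z @[z --> y^'+] --> - lim_left f (- y).
Proof.
move=> /(_ (- y))[cl _]; apply: cvgN.
by have /cvg_at_leftNP := cl; rewrite opprK.
Qed.

Lemma lim_left_reflect (R : realType) (f : R -> R) (y : R) : regulated f ->
  lim_left (reflect_field f) y = - lim_right f (- y).
Proof. by move=> rf; exact: cvg_lim (cvg_reflect_left (y := y) rf). Qed.

Lemma lim_right_reflect (R : realType) (f : R -> R) (y : R) : regulated f ->
  lim_right (reflect_field f) y = - lim_left f (- y).
Proof. by move=> rf; exact: cvg_lim (cvg_reflect_right (y := y) rf). Qed.

Lemma A1_reflect (R : realType) (f : R -> R) : A1 f -> A1 (reflect_field f).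
Proof.
move=> [[M fM] rf]; split; first by exists M => y; rewrite normrN.
move=> y; split; apply/cvg_ex.
  by exists (- lim_right f (- y)); exact: cvg_reflect_left.
by exists (- lim_left f (- y)); exact: cvg_reflect_right.
Qed.

(** The two one-sided limits swap and change sign, which preserves both their product and the
    pattern of a positive left limit with a negative right limit. *)
Lemma A2_reflect (R : realType) (f : R -> R) :
  regulated f -> A2 f -> A2 (reflect_field f).
Proof.
move=> rf a2 y; rewrite lim_left_reflect// lim_right_reflect// => H.
rewrite /reflect_field a2 ?oppr0//; move: H; rewrite mulrNN mulrC.
by case=> H; [left|right; lra].
Qed.

Lemma solution_reflect (R : realType) (f : R -> R) (x0 : R) (x : R -> R) :
  caratheodory_solution f x0 x ->
  caratheodory_solution (reflect_field f) (- x0) (fun t => - x t).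
Proof.
move=> sx t /sx[it ->].
have E : (fun s => (reflect_field f (- x s))%:E) = (fun s => - (f (x s))%:E)%E.
  by apply/funext => s; rewrite /reflect_field opprK.
split; first by rewrite E; exact: integrableN.
rewrite opprD; congr (_ + _).
rewrite -mulN1r -RintegralZl//; apply: eq_Rintegral => s _.
by rewrite /reflect_field opprK mulN1r.
Qed.

(** * Monotonicity of solutions *)

Lemma lipschitz_near (R : realType) (x : R -> R) (M : R) :
  (forall s t, 0 <= s -> s <= t -> `|x t - x s| <= M * (t - s)) ->
  forall s e, 0 <= s -> 0 < e ->
  exists2 d, 0 < d & forall r, 0 <= r -> `|r - s| < d -> `|x r - x s| < e.
Proof.
move=> xM s e s0 e0.
have M0 : 0 <= M by have := xM 0 1 (lexx 0) ler01; rewrite subr0 mulr1; apply: le_trans.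
exists (e / (M + 1)); first by rewrite divr_gt0//; lra.
move=> r r0; rewrite ltr_pdivlMr; last lra.
move=> rs.
have H : `|x r - x s| <= M * `|r - s|.
  have [sr|rs'] := leP s r; first by rewrite (ger0_norm (_ : 0 <= r - s)) ?subr_ge0//; exact: xM.
  rewrite distrC (distrC r) (gtr0_norm (_ : 0 < s - r)) ?subr_gt0//.
  by apply: xM => //; exact: ltW.
have [r0'|rn] := eqVneq r s; first by rewrite r0' subrr normr0.
have : 0 < `|r - s| by rewrite normr_gt0 subr_eq0.
lra.
Qed.

(** Here [s] is the last time in [[u, v]] at which the path is at or below [c], and [t] the first
    time after [s] at which it is at or above [d]. Continuity shows that both are attained. *)
Lemma first_passage (R : realType) (x : R -> R) (M c d u v : R) :
  (forall s t, 0 <= s -> s <= t -> `|x t - x s| <= M * (t - s)) ->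
  0 <= u -> u <= v -> c < d -> x u <= c -> d <= x v ->
  exists s t, [/\ u <= s, s < t, t <= v, x s <= c /\ d <= x t &
    forall r, s < r < t -> c < x r < d].
Proof.
move=> xM u0 uv cd xu xv.
have cont := lipschitz_near xM.
pose S := [set r | u <= r <= v /\ x r <= c].
have Su : S u by split; [rewrite lexx|].
have Sv : ubound S v by move=> r [/andP[]].
have hS : has_sup S by split; [exists u|exists v].
set s := sup S.
have us : u <= s by apply: ub_le_sup => //; exists v.
have sv : s <= v by apply: ge_sup => //; exists u.
have s0 : 0 <= s by lra.
have xs : x s <= c.
  rewrite leNgt; apply/negP => cs.
  have [k k0 Hk] := cont s (x s - c) s0 ltac:(lra).
  have [r [/andP[ur rv] xr] sr] := sup_adherent k0 hS.
  have rs : r <= s by apply: ub_le_sup; [exists v|split; [rewrite ur|]].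
  have := Hk r ltac:(lra); rewrite !ltr_norml -/s in sr *.
  by move=> /(_ ltac:(lra)); lra.
have xgt r : s < r <= v -> c < x r.
  move=> srv; rewrite ltNge; apply/negP => xr.
  have : S r by split; [lra|].
  by move=> /(ub_le_sup (ex_intro _ v Sv)); rewrite -/s; lra.
pose S' := [set r | s <= r <= v /\ d <= x r].
have S'v : S' v by split; [rewrite lexx sv|].
have S's : lbound S' s by move=> r [/andP[]].
have hS' : has_inf S' by split; [exists v|exists s].
set t := inf S'.
have st : s <= t by apply: lb_le_inf => //; exists v.
have tv : t <= v by apply: ge_inf => //; exists s.
have xt : d <= x t.
  rewrite leNgt; apply/negP => td.
  have [k k0 Hk] := cont t (d - x t) ltac:(lra) ltac:(lra).
  have [r [/andP[sr rv] xr] rt] := inf_adherent k0 hS'.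
  have tr : t <= r by apply: ge_inf; [exists s|split; [rewrite sr|]].
  have := Hk r ltac:(lra); rewrite !ltr_norml -/t in rt *.
  by move=> /(_ ltac:(lra)); lra.
have sltt : s < t.
  by rewrite lt_neqAle st andbT; apply/eqP => E; move: xt; rewrite -E; lra.
exists s, t; split => // r rst; apply/andP; split; first by apply: xgt; lra.
rewrite ltNge; apply/negP => xr.
have : S' r by split; [lra|].
by move=> /(ge_inf (ex_intro _ s S's)); rewrite -/t; lra.
Qed.

(** On a passage that stays inside []c, d[] the speed is at most [0], yet the path gains at least
    [d - c]. *)
Lemma no_up_crossing (R : realType) (f : R -> R) (x0 : R) (x : R -> R)
    (c d u v : R) :
  Defs.bounded_fun f -> caratheodory_solution f x0 x ->
  c < d -> (forall y, c < y < d -> f y <= 0) ->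
  0 <= u -> u <= v -> x u <= c -> d <= x v -> False.
Proof.
move=> [M fM] sx cd f0 u0 uv xu xv.
have [s [t [us st tv [xs xt] xr]]] :=
  first_passage (fun s t => @solution_lipschitz _ _ _ _ sx M s t fM) u0 uv cd xu xv.
suff : - M * (t - s) <= x t - x s <= 0 * (t - s) by lra.
apply: (solution_increment sx); [lra|lra|] => r rst.
by rewrite f0 ?andbT ?xr//; have := fM (x r); rewrite ler_norml; lra.
Qed.

Lemma no_down_crossing (R : realType) (f : R -> R) (x0 : R) (x : R -> R)
    (c d u v : R) :
  Defs.bounded_fun f -> caratheodory_solution f x0 x ->
  c < d -> (forall y, c < y < d -> 0 <= f y) ->
  0 <= u -> u <= v -> d <= x u -> x v <= c -> False.
Proof.
move=> [M fM] sx cd f0 u0 uv xu xv.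
have bf : Defs.bounded_fun (reflect_field f) by exists M => y; rewrite normrN.
apply: (no_up_crossing (c := - d) (d := - c) bf (solution_reflect sx) _ _ u0 uv).
- by rewrite ltrN2.
- by move=> y ycd; rewrite /reflect_field oppr_le0; apply: f0; lra.
- by rewrite lerN2.
- by rewrite lerN2.
Qed.

Lemma solution_no_peak (R : realType) (f : R -> R) (x0 : R) (x : R -> R)
    (u v w : R) : A1 f -> A2 f -> caratheodory_solution f x0 x ->
  0 <= u -> u <= v -> v <= w -> x u < x v -> x w < x v -> False.
Proof.
move=> [bf rf] a2 sx u0 uv vw xuv xwv.
pose m := Num.max (x u) (x w).
have mv : m < x v by rewrite /m gt_max xuv.
have um : x u <= m by rewrite /m le_max lexx.
have wm : x w <= m by rewrite /m le_max lexx orbT.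
have v0 := le_trans u0 uv.
have f0 p : m < p < x v -> f p = 0.
  move=> mpv; apply: a2; left; suff -> : lim_right f p = 0 by rewrite mulr0.
  apply/eqP/negP => /negP Ln0.
  have L_gt0 : 0 < `|lim_right f p| by rewrite normr_gt0.
  (* With the tolerance [|L|], [f] has weakly the sign of its right limit just above [p]. A negative
     sign forbids the climb from [u] to [v], a positive one the descent from [v] to [w]. *)
  have [k k0 Hk] := lim_right_close p rf L_gt0.
  pose d := Num.min (p + k) (x v).
  have pd : p < d by rewrite /d lt_min; apply/andP; split; lra.
  have dk : d <= p + k by rewrite /d ge_min lexx.
  have dv : d <= x v by rewrite /d ge_min lexx orbT.
  have [L0|L0|L0] := ltgtP (lim_right f p) 0; last by rewrite L0 eqxx in Ln0.
  - apply: (no_up_crossing bf sx pd _ u0 uv) => //; last lra.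
    move=> y yd; have := Hk y ltac:(lra).
    by rewrite (ltr0_norm L0) ler_norml; lra.
  - apply: (no_down_crossing bf sx pd _ v0 vw) => //; last lra.
    move=> y yd; have := Hk y ltac:(lra).
    by rewrite (gtr0_norm L0) ler_norml; lra.
by apply: (no_up_crossing bf sx mv _ u0 uv) => // y /f0 ->.
Qed.

Lemma solution_no_valley (R : realType) (f : R -> R) (x0 : R) (x : R -> R)
    (u v w : R) : A1 f -> A2 f -> caratheodory_solution f x0 x ->
  0 <= u -> u <= v -> v <= w -> x v < x u -> x v < x w -> False.
Proof.
move=> a1 a2 sx u0 uv vw xvu xvw.
have [_ rf] := a1.
apply: (solution_no_peak (A1_reflect a1) (A2_reflect rf a2)
  (solution_reflect sx) u0 uv vw); by rewrite ltrN2.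
Qed.

(** Suppose [x t < x s]. If [x 0 < x s], there is a peak at [s]. Otherwise [x t < x 0], which gives
    a peak at [t0] if [t0 <= t], and a valley at [t] if [t < t0]. *)
Lemma solution_nondecreasing (R : realType) (f : R -> R) (x0 : R) (x : R -> R)
    (t0 : R) : A1 f -> A2 f -> caratheodory_solution f x0 x ->
  0 <= t0 -> x 0 < x t0 -> forall s t, 0 <= s -> s <= t -> x s <= x t.
Proof.
move=> a1 a2 sx t00 xt0 s t s0 st; rewrite leNgt; apply/negP => xts.
have peak u v w : 0 <= u -> u <= v -> v <= w -> x u < x v -> x w < x v -> False.
  exact: solution_no_peak a1 a2 sx.
have valley u v w : 0 <= u -> u <= v -> v <= w -> x v < x u -> x v < x w -> False.
  exact: solution_no_valley a1 a2 sx.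
have [xs|xs] := ltP (x 0) (x s); first exact: (peak 0 s t).
have [tt0|t0t] := leP t0 t.
  by apply: (peak 0 t0 t) => //; lra.
by apply: (valley 0 t t0); lra.
Qed.

Lemma solution_monotone (R : realType) (f : R -> R) (x0 : R) (x : R -> R) :
  A1 f -> A2 f -> caratheodory_solution f x0 x -> monotone_on_nonneg x.
Proof.
move=> a1 a2 sx.
have [[t0 [t00 xt0]]|nup] := pselect (exists t0, 0 <= t0 /\ x 0 < x t0).
  by left; exact: solution_nondecreasing a1 a2 sx t00 xt0.
have [[t0 [t00 xt0]]|ndn] := pselect (exists t0, 0 <= t0 /\ x t0 < x 0).
  have [_ rf] := a1.
  right=> s t s0 st; rewrite -lerN2.
  apply: (solution_nondecreasing (A1_reflect a1) (A2_reflect rf a2)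
    (solution_reflect sx) t00 _ s0 st); by rewrite ltrN2.
have cst t : 0 <= t -> x t = x 0.
  move=> t0; have [xt|xt|//] := ltgtP (x t) (x 0).
    by exfalso; apply: ndn; exists t.
  by exfalso; apply: nup; exists t.
by left=> s t s0 st; rewrite !cst//; exact: le_trans st.
Qed.

(** * Closedness of the solution set *)

Lemma exists_lower (R : realType) (a b : R) :
  0 < a -> 0 < b -> exists k, [/\ 0 < k, k <= a & k <= b].
Proof.
move=> a0 b0; exists (Num.min a b); split; first by rewrite lt_min a0.
  by rewrite ge_min lexx.
by rewrite ge_min lexx orbT.
Qed.

Lemma field_neq0_limits_neq0 (R : realType) (f : R -> R) (p : R) :
  A2 f -> f p != 0 -> (lim_left f p != 0) && (lim_right f p != 0).
Proof.
move=> a2; apply: contraR; rewrite negb_and !negbK => H.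
apply/eqP/a2; left.
by case/orP: H => /eqP ->; rewrite ?mul0r ?mulr0.
Qed.

Lemma solution_speed_ge (R : realType) (f : R -> R) (x0 : R) (y : R -> R)
    (s n L : R) : caratheodory_solution f x0 y -> 0 <= s -> 0 < n ->
  (forall r, s < r < s + n -> `|f (y r) - L| <= `|L| / 2) ->
  `|L| / 2 * n <= `|y (s + n) - y s|.
Proof.
move=> sy s0 n0 fL.
have := solution_increment_near sy s0 (ltac:(lra) : s <= s + n) fL.
rewrite (_ : s + n - s = n); last lra.
have := ler_normB (y (s + n) - y s) (y (s + n) - y s - L * n).
rewrite subKr normrM (gtr0_norm n0); lra.
Qed.

(** Suppose [f p] is nonzero, so that both one-sided limits are, and cut [[s, t]] into thirds of
    length [n]. A monotone solution [y] close to [p] is either below [p] throughout the first third,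
    or above [p] throughout the last, or equal to [p] on the middle one. The first two cases force a
    displacement too large for [y] to stay near [p]; the third gives [f p * n = 0]. *)
Lemma field_zero_of_stalling (R : realType) (f : R -> R) (x0 p s t : R) :
  A1 f -> A2 f -> 0 <= s -> s < t ->
  (forall e, 0 < e -> exists y, [/\ caratheodory_solution f x0 y,
     forall s t, 0 <= s -> s <= t -> y s <= y t &
     forall r, s <= r <= t -> p - e < y r < p + e]) ->
  f p = 0.
Proof.
move=> [_ rf] a2 s0 st stall; apply/eqP/negP => /negP fn0.
have /andP[l0 r0] := field_neq0_limits_neq0 a2 fn0.
set Ll := lim_left f p in l0; set Lr := lim_right f p in r0.
have l0' : 0 < `|Ll| / 2 by rewrite divr_gt0// normr_gt0.
have r0' : 0 < `|Lr| / 2 by rewrite divr_gt0// normr_gt0.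
have [dl dl0 Hl] := lim_left_close p rf l0'.
have [dr dr0 Hr] := lim_right_close p rf r0'.
have [n n0 tE] : exists2 n, 0 < n & t = s + n + n + n.
  by exists ((t - s) / 3); lra.
have [d [d0 ddl ddr]] := exists_lower dl0 dr0.
have [c [c0 cl cr]] := exists_lower l0' r0'.
(* [c] is a lower bound for the speed on either side of [p]. Two values within [c * n / 2] of [p]
   differ by less than [c * n], the distance covered in one third at that speed. *)
have cn0 : 0 < c * n / 2 by rewrite divr_gt0// mulr_gt0.
have [k [k0 kd kc]] := exists_lower d0 cn0.
have [y [sy my yp]] := stall k k0.
have slow u v : s <= u <= t -> s <= v <= t -> `|y u - y v| < c * n.
  by move=> /yp yu /yp yv; rewrite ltr_norml; clear - yu yv kc; lra.
have fast L u : 0 <= u -> c <= `|L| / 2 ->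
    (forall r, u < r < u + n -> `|f (y r) - L| <= `|L| / 2) ->
    c * n <= `|y (u + n) - y u|.
  move=> u0 cL H; apply: le_trans (solution_speed_ge sy u0 n0 H).
  by rewrite ler_pM2r.
clear stall kc cn0; subst t.
have [yl|yl] := ltP (y (s + n)) p.
  have := slow (s + n) s ltac:(clear - n0; lra) ltac:(clear - n0; lra).
  rewrite ltNge => /negP; apply; apply: (fast Ll) => // r rs; apply: Hl.
  have rn : r <= s + n by clear - rs; lra.
  have := my r (s + n) ltac:(clear - rs s0; lra) rn.
  have := yp r ltac:(clear - rs n0; lra).
  by clear - yl ddl kd; lra.
have [yr|yr] := ltP p (y (s + n + n)).
  have := slow (s + n + n + n) (s + n + n) ltac:(clear - n0; lra) ltac:(clear - n0; lra).
  rewrite ltNge => /negP; apply; apply: (fast Lr) => //; first by clear - s0 n0; lra.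
  move=> r rs; apply: Hr.
  have rn : s + n + n <= r by clear - rs; lra.
  have := my (s + n + n) r ltac:(clear - n0 s0; lra) rn.
  have := yp r ltac:(clear - rs n0; lra).
  by clear - yr ddr kd; lra.
have yE r : s + n <= r <= s + n + n -> y r = p.
  move=> /andP[r1 r2]; have := my (s + n) r ltac:(clear - n0 s0; lra) r1.
  have := my r (s + n + n) ltac:(clear - r1 n0 s0; lra) r2.
  by clear - yl yr; lra.
have : f p * (s + n + n - (s + n)) <= y (s + n + n) - y (s + n)
         <= f p * (s + n + n - (s + n)).
  apply: (solution_increment sy); [clear - s0 n0; lra|clear - n0; lra|].
  by move=> r rs; rewrite yE ?lexx//; clear - rs; lra.
rewrite !yE; [|clear - n0; lra..].
rewrite subrr (_ : s + n + n - (s + n) = n); last by clear; lra.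
by move=> /le_anti/eqP; rewrite mulf_eq0 (negbTE fn0) gt_eqF.
Qed.

Section closed.
Variables (R : realType) (f : R -> R) (x0 : R) (x : R -> R).
Hypotheses (a1 : A1 f) (a2 : A2 f).
Hypothesis approx : forall T e, 0 < e -> exists y,
  [/\ caratheodory_solution f x0 y,
      forall s t, 0 <= s -> s <= t -> y s <= y t &
      forall t, 0 <= t <= T -> `|y t - x t| < e].

Let approx_between s t e : 0 <= s -> s <= t -> 0 < e -> exists y,
  [/\ caratheodory_solution f x0 y,
      forall s t, 0 <= s -> s <= t -> y s <= y t &
      forall r, s <= r <= t -> x r - e < y r < x r + e].
Proof.
move=> s0 st e0; have [y [sy my yx]] := approx t e0; exists y; split => // r rst.
by have := yx r ltac:(lra); rewrite ltr_norml; lra.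
Qed.

Lemma limit_nondecreasing s t : 0 <= s -> s <= t -> x s <= x t.
Proof.
move=> s0 st; apply/ler_addgt0Pr => e e0.
have [y [sy my yx]] := approx_between s0 st (ltac:(lra) : 0 < e / 2).
have := my s t s0 st; have := yx s ltac:(lra); have := yx t ltac:(lra); lra.
Qed.

Lemma limit_init : x 0 = x0.
Proof.
apply: (@eq_of_dist_le R _ _ 1) => e e0; rewrite mulr1 ler_norml.
have [y [sy _ yx]] := approx_between (lexx 0) (lexx 0) e0.
have := yx 0 ltac:(lra); rewrite (solution_init sy); lra.
Qed.

Lemma limit_lipschitz M s t : (forall y, `|f y| <= M) ->
  0 <= s -> s <= t -> `|x t - x s| <= M * (t - s).
Proof.
move=> fM s0 st; apply/ler_addgt0Pr => e e0.
have [y [sy my yx]] := approx_between s0 st (ltac:(lra) : 0 < e / 2).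
have := solution_lipschitz sy fM s0 st.
have := yx s ltac:(lra); have := yx t ltac:(lra); rewrite !ler_norml; lra.
Qed.

(** The strict inequalities at [s] and [t] leave a margin: a nondecreasing approximant that is close
    enough stays in []c, d[] on all of [[s, t]], and its increment estimate passes to the limit. *)
Lemma limit_increment_near_cc c d L e s t : 0 <= s -> s <= t ->
  c < x s -> x t < d -> (forall y, c < y < d -> `|f y - L| <= e) ->
  `|x t - x s - L * (t - s)| <= e * (t - s).
Proof.
move=> s0 st cs td fL; apply/ler_addgt0Pr => k k0.
have [k1 [k10 k1k k1c]] := exists_lower (ltac:(lra) : 0 < k / 2) (ltac:(lra) : 0 < x s - c).
have [k2 [k20 k2k k2d]] := exists_lower k10 (ltac:(lra) : 0 < d - x t).
have [y [sy my yx]] := approx_between s0 st k20.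
have ys := yx s ltac:(lra); have yt := yx t ltac:(lra).
have : `|y t - y s - L * (t - s)| <= e * (t - s).
  apply: (solution_increment_near sy s0 st) => r rst; apply: fL.
  have := my s r s0 ltac:(lra); have := my r t ltac:(lra) ltac:(lra); lra.
rewrite !ler_norml; lra.
Qed.

(** Here [x] may touch [c] or [d] at the end times, as it does when [c] or [d] is the value of [x]
    at the point under study. The margin is recovered by shrinking to [[s + h, t - h]]. *)
Lemma limit_increment_near c d L e s t : 0 <= s -> s < t ->
  (forall r, s < r < t -> c < x r < d) ->
  (forall y, c < y < d -> `|f y - L| <= e) ->
  `|x t - x s - L * (t - s)| <= e * (t - s).
Proof.
move=> s0 st xcd fL; apply/ler_addgt0Pr => k k0.
have [[M fM] _] := a1.
have M0 : 0 <= M by apply: le_trans (fM 0).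
have e0 : 0 <= e by apply: le_trans (fL _ (xcd ((s + t) / 2) ltac:(lra))).
(* Cutting off the ends costs at most [2 * M * h] for the path and [2 * |L| * h] for the linear
   term, together at most [k]. *)
have [h [h0 hst hk]] := exists_lower (ltac:(lra) : 0 < (t - s) / 4)
  (ltac:(by rewrite divr_gt0//; have := normr_ge0 L; lra) :
    0 < k / (2 * M + 2 * `|L| + 1)).
rewrite ler_pdivlMr in hk; last by have := normr_ge0 L; lra.
have H1 := limit_lipschitz fM s0 (ltac:(lra) : s <= s + h).
have H2 := limit_lipschitz fM (ltac:(lra) : 0 <= t - h) (ltac:(lra) : t - h <= t).
have := @limit_increment_near_cc c d L e (s + h) (t - h) ltac:(lra) ltac:(lra).
have /andP[cx _] := xcd (s + h) ltac:(lra).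
have /andP[_ xd] := xcd (t - h) ltac:(lra).
move=> /(_ cx xd fL).
have Lh : - (`|L| * h) <= L * h <= `|L| * h.
  by rewrite -ler_norml normrM (gtr0_norm h0).
have eh : 0 <= e * h by rewrite mulr_ge0// ltW.
rewrite !ler_norml in H1 H2 *; lra.
Qed.

Lemma limit_flat_zero s t : 0 <= s -> s < t -> x s = x t -> f (x s) = 0.
Proof.
move=> s0 st xst; apply: (field_zero_of_stalling a1 a2 s0 st) => k k0.
have [y [sy my yx]] := approx_between s0 (ltW st) k0.
exists y; split; [exact: sy|exact: my|] => r rst.
have := yx r rst; suff -> : x r = x s by [].
case/andP: rst => sr rt; apply/le_anti; rewrite [X in _ <= X]xst.
by rewrite !limit_nondecreasing//; exact: le_trans sr.
Qed.

(** On each side of [p] there are two cases. If [x] keeps the value [x p] for a while, then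
    [f (x p) = 0] and the slope is [0]. If it leaves [x p] at once, monotonicity keeps it strictly
    on one side of [x p], and the slope is the corresponding one-sided limit of [f]. *)
Lemma limit_solution : caratheodory_solution f x0 x.
Proof.
have [[M fM] rf] := a1.
have cont := lipschitz_near (fun s t => @limit_lipschitz M s t fM).
apply: solution_of_local_slopes limit_init _ => T T0; split=> p e pT e0.
- have [[t pt xpt]|npt] := pselect (exists2 t, p < t & x p = x t).
    have xE q : p < q < t -> x q = x p.
      move=> pqt; have := limit_nondecreasing (ltac:(lra) : 0 <= p) (ltac:(lra) : p <= q).
      have := limit_nondecreasing (ltac:(lra) : 0 <= q) (ltac:(lra) : q <= t); lra.
    exists 0, (t - p); first lra.
    move=> q pq; rewrite /= xE; last lra.
    rewrite (limit_flat_zero _ pt xpt); last lra.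
    rewrite !subrr mul0r normr0; split; first exact: ltW.
    by rewrite subr0 normr0 mulr_ge0//; lra.
  have [d d0 fd] := lim_right_close (x p) rf e0.
  have [k k0 xk] := cont p d ltac:(lra) d0.
  have xpq q : p < q < p + k -> x p < x q < x p + d.
    move=> pq; have := xk q ltac:(lra); rewrite !ltr_norml.
    move=> /(_ ltac:(lra)) xq; rewrite (_ : x q < _) ?andbT; last lra.
    rewrite lt_neqAle limit_nondecreasing ?andbT; [|lra|lra].
    by apply/eqP => E; apply: npt; exists q => //; lra.
  exists (lim_right f (x p)), k => // q pq; split; first exact/fd/xpq.
  apply: (@limit_increment_near (x p) (x p + d)) => //; [lra|lra|].
  by move=> r pr; apply: xpq; lra.
- have [[t tp xpt]|npt] := pselect (exists2 t, 0 <= t < p & x t = x p).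
    have xE q : t < q < p -> x q = x p.
      move=> pqt; have := limit_nondecreasing (ltac:(lra) : 0 <= q) (ltac:(lra) : q <= p).
      have := limit_nondecreasing (ltac:(lra) : 0 <= t) (ltac:(lra) : t <= q); lra.
    exists 0, (p - t); first lra.
    move=> q pq; rewrite /= xE; last lra.
    rewrite -xpt (limit_flat_zero _ _ xpt); [|lra|lra].
    rewrite !subrr mul0r normr0; split; first exact: ltW.
    by rewrite subr0 normr0 mulr_ge0//; lra.
  have [d d0 fd] := lim_left_close (x p) rf e0.
  have [k' k'0 xk] := cont p d ltac:(lra) d0.
  have [k [k0 kk' kp]] := exists_lower k'0 (ltac:(lra) : 0 < p).
  have xpq q : p - k < q < p -> x p - d < x q < x p.
    move=> pq; have := xk q ltac:(lra); rewrite !ltr_norml.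
    move=> /(_ ltac:(lra)) xq; rewrite (_ : _ < x q) /=; last lra.
    rewrite lt_neqAle limit_nondecreasing ?andbT; [|lra|lra].
    by apply/eqP => E; apply: npt; exists q => //; lra.
  exists (lim_left f (x p)), k => // q pq; split; first exact/fd/xpq.
  apply: (@limit_increment_near (x p - d) (x p)) => //; [lra|lra|].
  by move=> r pr; apply: xpq; lra.
Qed.

End closed.

(** If nondecreasing solutions do not approximate [x] at some horizon [T1] and precision [e1], then
    every solution that approximates [x] at least that well is nonincreasing, and reflection
    applies. *)
Lemma solutions_closed (R : realType) (f : R -> R) (x0 : R)
    (F : set_system (R -> R)) (x : R -> R) :
  A1 f -> A2 f -> ProperFilter F -> F (caratheodory_solution f x0) ->
  cvg_unif_bounded F x -> caratheodory_solution f x0 x.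
Proof.
move=> a1 a2 PF Fsol Fx.
pose near T e (y : R -> R) := forall t, 0 <= t <= T -> `|y t - x t| < e.
have [up|/existsNP[T1 /existsNP[e1 /not_implyP[e10 nup]]]] :=
  pselect (forall T e, 0 < e -> exists y, [/\ caratheodory_solution f x0 y,
    forall s t, 0 <= s -> s <= t -> y s <= y t & near T e y]).
  exact: limit_solution a1 a2 up.
have [_ rf] := a1.
rewrite -[f]reflect_fieldK -[x0]opprK.
rewrite [x](_ : _ = fun t => - - x t); last by apply/funext => t; rewrite opprK.
apply: solution_reflect.
apply: (limit_solution (A1_reflect a1) (A2_reflect rf a2)) => T e e0.
have [k [k0 ke ke1]] := exists_lower e0 e10.
have [y [sy yx]] := filter_ex (filterI Fsol (Fx (Num.max T T1) k k0)).
have [my|my] := solution_monotone a1 a2 sy.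
  exfalso; apply: nup; exists y; split => // t tT1.
  apply: lt_le_trans (yx t _) ke1.
  by case/andP: tT1 => -> tT1; rewrite le_max tT1 orbT.
exists (fun t => - y t); split; first exact: solution_reflect.
  by move=> s t s0 st; rewrite lerN2; exact: my.
move=> t /andP[t0 tT]; rewrite -opprD normrN.
by apply: lt_le_trans (yx t _) ke; rewrite t0 le_max tT.
Qed.

(** * Existence: the travel time through an uphill range *)

Lemma local_slopes_increment (R : realType) (x h : R -> R) (a b l u : R) :
  a < b -> local_slopes x h a b -> (forall r, a < r < b -> l <= h r <= u) ->
  l * (b - a) <= x b - x a <= u * (b - a).
Proof.
move=> ab sl hlu.
have ih := regulated_on_integrable ab (local_slopes_regulated_on sl).
have := Rintegral_itv_increment_bounds ih (lexx a) (ltW ab) (lexx b) hlu.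
rewrite (local_slopes_Rintegral ab sl) set_itv1 Rintegral_set1; lra.
Qed.

Lemma lim_right_ge (R : realType) (f : R -> R) (p c d : R) : regulated f ->
  0 < d -> (forall q, p < q < p + d -> c <= f q) -> c <= lim_right f p.
Proof.
move=> rf d0 fc; apply/ler_addgt0Pr => e e0.
have [k k0 fk] := lim_right_close p rf e0.
have [m [m0 md mk]] := exists_lower d0 k0.
have := fc (p + m / 2) ltac:(lra); have := fk (p + m / 2) ltac:(lra).
by rewrite ler_norml; lra.
Qed.

Lemma lim_left_ge (R : realType) (f : R -> R) (p c d : R) : regulated f ->
  0 < d -> (forall q, p - d < q < p -> c <= f q) -> c <= lim_left f p.
Proof.
move=> rf d0 fc; apply/ler_addgt0Pr => e e0.
have [k k0 fk] := lim_left_close p rf e0.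
have [m [m0 md mk]] := exists_lower d0 k0.
have := fc (p - m / 2) ltac:(lra); have := fk (p - m / 2) ltac:(lra).
by rewrite ler_norml; lra.
Qed.

Lemma inv_near (R : realType) (L e : R) : 0 < L -> 0 < e ->
  exists2 d, 0 < d & forall v, `|v - L| <= d -> `|v^-1 - L^-1| <= e.
Proof.
move=> L0 e0; have /cvgrPdist_le/(_ e e0) := @inv_continuous R L (lt0r_neq0 L0).
move=> /nbhs_ballP[d /= d0 Hd]; exists (d / 2); first lra.
move=> v vL; rewrite distrC; apply: Hd; rewrite /ball/= distrC; lra.
Qed.

(* [lra] otherwise unfolds the limits while collecting its atoms. *)
#[local] Opaque lim_left lim_right.

Section rising.
Variables (R : realType) (f : R -> R) (x0 M : R).
Hypotheses (rf : regulated f) (a2 : A2 f).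
Hypotheses (M0 : 0 < M) (fM : forall y, f y <= M).
Hypothesis start : 0 < lim_right f x0.

(* At [x0] itself only the right limit is constrained, by [start]. *)
Definition uphill (z : R) : Prop := x0 <= z /\
  forall p, x0 < p <= z -> 0 < lim_left f p /\ 0 < lim_right f p.

(* Points where [f] vanishes or is negative between positive one-sided limits are
   harmless ([0^-1 = 0]): they are isolated. *)
Definition travel_time (z : R) : R :=
  \int[@lebesgue_measure R]_(y in `[x0, z]) (f y)^-1.

Local Notation A := uphill.
Local Notation T := travel_time.

Lemma uphill_start : A x0.
Proof. by split=> [|p]; [exact: lexx|rewrite lt_le_asym]. Qed.

Lemma uphill_down z w : A z -> x0 <= w -> w <= z -> A w.
Proof. by move=> [_ H] xw wz; split=> [|p pw]; [exact: xw|apply: H; lra]. Qed.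

Lemma uphill_right z : A z -> 0 < lim_right f z.
Proof.
move=> [xz H]; move: xz; rewrite le_eqVlt => /predU1P[<-//|xz].
by have [] := H z (introT andP (conj xz (lexx z))).
Qed.

Lemma uphill_left z : A z -> x0 < z -> 0 < lim_left f z.
Proof. by move=> [_ /(_ z)]; rewrite lexx andbT => H /H[]. Qed.

(** Just above [z] the values of [f] are at least half the right limit at [z], hence so are all
    one-sided limits there. *)
Lemma uphill_open z : A z -> exists2 d, 0 < d & A (z + d).
Proof.
move=> Az; have L0 := uphill_right Az; have [xz H] := Az.
set L := lim_right f z in L0.
have [d d0 fd] := lim_right_close z rf (ltac:(lra) : 0 < L / 2).
have fL q : z < q < z + d -> L / 2 <= f q.
  by move=> /fd; rewrite ler_norml -/L; lra.
exists (d / 2); [lra|split; first lra] => p pz.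
have [pz'|zp] := leP p z; first by apply: H; lra.
suff [] : L / 2 <= lim_left f p /\ L / 2 <= lim_right f p by lra.
split.
  by apply: (@lim_left_ge _ _ _ _ (p - z)) => // [|q pq]; [lra|apply: fL; lra].
by apply: (@lim_right_ge _ _ _ _ (d / 2)) => // [|q pq]; [lra|apply: fL; lra].
Qed.

Lemma uphill_regulated z : A z -> regulated_on (fun y => (f y)^-1) x0 z.
Proof.
move=> Az; split=> p e pz e0.
  have /uphill_right L0 : A p by apply: (uphill_down Az); lra.
  have [k k0 Hk] := inv_near L0 e0.
  have [d d0 Hd] := lim_right_close p rf k0.
  by exists (lim_right f p)^-1, d => // q /Hd/Hk.
have Ap : A p by apply: (uphill_down Az); lra.
have L0 := uphill_left Ap (ltac:(lra) : x0 < p).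
have [k k0 Hk] := inv_near L0 e0.
have [d d0 Hd] := lim_left_close p rf k0.
by exists (lim_left f p)^-1, d => // q /Hd/Hk.
Qed.

Lemma travel_time_start : T x0 = 0.
Proof. by rewrite /T set_itv1 Rintegral_set1. Qed.

Lemma travel_time_increment z s t l u : A z -> x0 <= s -> s < t -> t <= z ->
  0 < l -> l <= u -> (forall q, s < q < t -> l <= f q <= u) ->
  t - s <= u * (T t - T s) /\ l * (T t - T s) <= t - s.
Proof.
move=> Az xs st tz l0 lu flu.
have xz : x0 < z by lra.
have ih := regulated_on_integrable xz (uphill_regulated Az).
have u0 : 0 < u by lra.
have hlu q : s < q < t -> u^-1 <= (f q)^-1 <= l^-1.
  move=> /flu/andP[lf fu]; have f0 := lt_le_trans l0 lf.
  by rewrite !lef_pV2 ?posrE// fu.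
have /andP[] := Rintegral_itv_increment_bounds ih xs (ltW st) tz hlu.
rewrite -/(T t) -/(T s) => H1 H2; split.
  by rewrite mulrC -ler_pdivrMr// mulrC.
by rewrite mulrC -ler_pdivlMr// mulrC.
Qed.

(** The bound [f <= M] gives [1 / f >= 1 / M] only where [f > 0], which the limits guarantee beside
    each point but not at it. Interval induction chains the local estimates. *)
Lemma travel_time_growth z s t : A z -> x0 <= s -> s <= t -> t <= z ->
  t - s <= M * (T t - T s).
Proof.
move=> Az xs; rewrite le_eqVlt => /predU1P[->|st tz]; first by rewrite !subrr mulr0.
pose P s t := t - s <= M * (T t - T s).
apply: (@cousin R P s t) => //; rewrite /P.
- by move=> *; lra.
- move=> p pst.
  have /uphill_right L0 : A p by apply: (uphill_down Az); lra.
  set L := lim_right f p in L0.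
  have [d d0 fd] := lim_right_close p rf (ltac:(lra) : 0 < L / 2).
  exists d => // q pq qt.
  have LM : L / 2 <= M.
    have := fd ((p + q) / 2) ltac:(lra); have := fM ((p + q) / 2).
    by rewrite -/L ler_norml; lra.
  suff [] : q - p <= M * (T q - T p) /\ L / 2 * (T q - T p) <= q - p by [].
  apply: (travel_time_increment Az) => //; [lra..|] => r pr.
  by rewrite fM andbT; have := fd r ltac:(lra); rewrite -/L ler_norml; lra.
- move=> p pst.
  have Ap : A p by apply: (uphill_down Az); lra.
  have L0 := uphill_left Ap (ltac:(lra) : x0 < p).
  set L := lim_left f p in L0.
  have [d d0 fd] := lim_left_close p rf (ltac:(lra) : 0 < L / 2).
  exists d => // q pq qt.
  have LM : L / 2 <= M.
    have := fd ((p + q) / 2) ltac:(lra); have := fM ((p + q) / 2).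
    by rewrite -/L ler_norml; lra.
  suff [] : p - q <= M * (T p - T q) /\ L / 2 * (T p - T q) <= p - q by [].
  apply: (travel_time_increment Az) => //; [lra..|] => r pr.
  by rewrite fM andbT; have := fd r ltac:(lra); rewrite -/L ler_norml; lra.
Qed.

Lemma travel_time_lt z s t : A z -> x0 <= s -> s < t -> t <= z -> T s < T t.
Proof.
move=> Az xs st tz; have := travel_time_growth Az xs (ltW st) tz => H.
by rewrite -subr_gt0 -(pmulr_rgt0 _ M0); lra.
Qed.

Lemma travel_time_right p e : A p -> 0 < e -> exists d, [/\ 0 < d, A (p + d) &
  forall q, p < q < p + d -> `|f q - lim_right f p| <= e /\
    `|q - p - lim_right f p * (T q - T p)| <= e * (T q - T p)].
Proof.
move=> Ap e0; have L0 := uphill_right Ap; set L := lim_right f p in L0 *.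
(* The bound [e1 <= L / 2] keeps [L - e1] positive, as a lower bound on [f] must be before it is
   inverted. *)
have [e1 [e10 e1e e1L]] := exists_lower e0 (ltac:(lra) : 0 < L / 2).
have [k k0 fk] := lim_right_close p rf e10.
have [k' k'0 Ak'] := uphill_open Ap.
have [d [d0 dk dk']] := exists_lower k0 k'0.
have xp : x0 <= p by case: Ap.
have Ad : A (p + d) by apply: (uphill_down Ak'); lra.
exists d; split => // q pq; split.
  by apply: le_trans e1e; apply: fk; lra.
have Tpq := travel_time_lt Ad xp (ltac:(lra) : p < q) (ltac:(lra) : q <= p + d).
have [] : q - p <= (L + e1) * (T q - T p) /\ (L - e1) * (T q - T p) <= q - p.
  apply: (travel_time_increment Ad xp); [lra..|].
  by move=> r pr; have := fk r ltac:(lra); rewrite -/L ler_norml; lra.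
have : 0 <= (e - e1) * (T q - T p) by apply: mulr_ge0; lra.
rewrite ler_norml; lra.
Qed.

Lemma travel_time_left p e : A p -> x0 < p -> 0 < e -> exists d,
  [/\ 0 < d, x0 <= p - d &
  forall q, p - d < q < p -> `|f q - lim_left f p| <= e /\
    `|p - q - lim_left f p * (T p - T q)| <= e * (T p - T q)].
Proof.
move=> Ap xp e0; have L0 := uphill_left Ap xp; set L := lim_left f p in L0 *.
have [e1 [e10 e1e e1L]] := exists_lower e0 (ltac:(lra) : 0 < L / 2).
have [k k0 fk] := lim_left_close p rf e10.
have [d [d0 dk dp]] := exists_lower k0 (ltac:(lra) : 0 < p - x0).
exists d; split => // [|q pq]; first lra.
have xq : x0 <= q by lra.
split; first by apply: le_trans e1e; apply: fk; lra.
have Tpq := travel_time_lt Ap xq (ltac:(lra) : q < p) (lexx p).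
have [] : p - q <= (L + e1) * (T p - T q) /\ (L - e1) * (T p - T q) <= p - q.
  apply: (travel_time_increment Ap xq); [lra..|].
  by move=> r pr; have := fk r ltac:(lra); rewrite -/L ler_norml; lra.
have : 0 <= (e - e1) * (T p - T q) by apply: mulr_ge0; lra.
rewrite ler_norml; lra.
Qed.

(** * Existence: the inverse of the travel time is a solution *)

(** A generalized inverse of the travel time, meaningful for every [t >= 0]: when the uphill range
    is used up, the supremum is its end point, so the path stops there without a case
    distinction. *)
Definition rising_path (t : R) : R := sup [set z | A z /\ T z <= t].

Local Notation x := rising_path.

Lemma rising_path_has_sup t : 0 <= t -> has_sup [set z | A z /\ T z <= t].
Proof.
move=> t0; split.
  by exists x0; split; [exact: uphill_start|rewrite travel_time_start].
exists (x0 + M * t) => z [Az Tz]; have [xz _] := Az.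
have := travel_time_growth Az (lexx x0) xz (lexx z); rewrite travel_time_start => H.
by have : M * T z <= M * t by [rewrite ler_pM2l]; lra.
Qed.

Lemma rising_path_ub t z : 0 <= t -> A z -> T z <= t -> z <= x t.
Proof. by move=> t0 Az Tz; apply: ub_le_sup; [case: (rising_path_has_sup t0)|]. Qed.

Lemma rising_path_ge t : 0 <= t -> x0 <= x t.
Proof.
move=> t0; apply: rising_path_ub => //; first exact: uphill_start.
by rewrite travel_time_start.
Qed.

Lemma rising_path_below t w : 0 <= t -> x0 <= w -> w < x t -> A w /\ T w <= t.
Proof.
move=> t0 xw wx.
have [z [Az Tz] wz] := sup_adherent (ltac:(lra) : 0 < x t - w) (rising_path_has_sup t0).
rewrite -/(x t) in wz; have {}wz : w < z by lra.
split; first by apply: (uphill_down Az) => //; exact: ltW.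
by apply: le_trans Tz; apply: ltW; exact: (travel_time_lt Az).
Qed.

Lemma travel_time_ge0 z : A z -> 0 <= T z.
Proof.
move=> Az; have [xz _] := Az.
have := travel_time_growth Az (lexx x0) xz (lexx z); rewrite travel_time_start subr0.
by move=> H; rewrite -(pmulr_rge0 _ M0); lra.
Qed.

Lemma rising_pathK z : A z -> x (T z) = z.
Proof.
move=> Az; have Tz0 := travel_time_ge0 Az; apply/le_anti/andP; split.
  apply: ge_sup; first by case: (rising_path_has_sup Tz0).
  move=> w [Aw Tw]; rewrite leNgt; apply/negP => zw.
  have [xz _] := Az.
  by have := travel_time_lt Aw xz zw (lexx w); lra.
exact: rising_path_ub.
Qed.

Lemma rising_path_mono s t : 0 <= s -> s <= t -> x s <= x t.
Proof.
move=> s0 st; apply: ge_sup; first by case: (rising_path_has_sup s0).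
move=> z [Az Tz]; apply: rising_path_ub => //; exact: le_trans st.
Qed.

(** The travel time is at most [t] just below [x t] and exceeds [t] just above it. The slope
    estimates with tolerance [L / 2] bound its increments by [2 / L] times the distance, so both
    inequalities pass to [x t]. *)
Lemma rising_path_time t : 0 <= t -> A (x t) -> T (x t) = t.
Proof.
move=> t0 Ax; have xx := rising_path_ge t0; apply/le_anti/andP; split.
  have [->|xn] := eqVneq (x t) x0; first by rewrite travel_time_start.
  have xlt : x0 < x t by rewrite lt_neqAle eq_sym xn.
  apply/ler_addgt0Pr => k k0; have L0 := uphill_left Ax xlt.
  have [d [d0 xd H]] := travel_time_left Ax xlt (ltac:(lra) : 0 < lim_left f (x t) / 2).
  set L := lim_left f (x t) in L0 H.
  have Lk : 0 < L / 2 * k by rewrite mulr_gt0//; lra.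
  have [m [m0 md mk]] := exists_lower d0 Lk.
  have [_ ] := H (x t - m / 2) ltac:(lra).
  have [_ Tw] := @rising_path_below t (x t - m / 2) t0 ltac:(lra) ltac:(lra).
  rewrite ler_norml => /andP[H1 _].
  have H2 : L / 2 * (T (x t) - T (x t - m / 2)) <= L / 2 * k by lra.
  by rewrite ler_pM2l in H2; lra.
apply/ler_addgt0Pr => k k0; have L0 := uphill_right Ax.
have [d [d0 Ad H]] := travel_time_right Ax (ltac:(lra) : 0 < lim_right f (x t) / 2).
set L := lim_right f (x t) in L0 H.
have Lk : 0 < L / 2 * k by rewrite mulr_gt0//; lra.
have [m [m0 md mk]] := exists_lower d0 Lk.
have [_ ] := H (x t + m / 2) ltac:(lra).
have Tw : t < T (x t + m / 2).
  rewrite ltNge; apply/negP => Tw.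
  have /(rising_path_ub t0) : A (x t + m / 2) by apply: (uphill_down Ad); lra.
  by move=> /(_ Tw); lra.
rewrite ler_norml => /andP[H1 _].
have H2 : L / 2 * (T (x t + m / 2) - T (x t)) <= L / 2 * k by lra.
by rewrite ler_pM2l in H2; lra.
Qed.

(** If [f (x t)] were nonzero, so would be both one-sided limits. The left one cannot be negative,
    because points below [x t] have positive right limits; the right one cannot be negative either,
    by the second case of (A2). Then [x t] would be uphill. *)
Lemma rising_path_stop t : 0 <= t -> ~ A (x t) -> f (x t) = 0.
Proof.
move=> t0 nA; apply/eqP/negP => /negP fn0; apply: nA.
have xx := rising_path_ge t0.
have Aw w : x0 <= w -> w < x t -> A w.
  by move=> xw wx; have [] := rising_path_below t0 xw wx.
have /andP[l0 r0] := field_neq0_limits_neq0 a2 fn0.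
have [E|xn] := eqVneq (x t) x0; first by rewrite E; exact: uphill_start.
have xlt : x0 < x t by rewrite lt_neqAle eq_sym xn.
have lpos : 0 < lim_left f (x t).
  rewrite lt_neqAle eq_sym l0 leNgt; apply/negP => Lneg.
  set L := lim_left f (x t) in Lneg.
  have [d d0 fd] := lim_left_close (x t) rf (ltac:(lra) : 0 < - L / 2).
  have [m [m0 md mx]] := exists_lower d0 (ltac:(lra) : 0 < x t - x0).
  have /uphill_right L'0 : A (x t - m / 2) by apply: Aw; lra.
  set L' := lim_right f _ in L'0.
  have [k k0 fk] := lim_right_close (x t - m / 2) rf (ltac:(lra) : 0 < L' / 2).
  have [n [n0 nk nm]] := exists_lower k0 m0.
  have := fk (x t - m / 2 + n / 4) ltac:(lra).
  have := fd (x t - m / 2 + n / 4) ltac:(lra).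
  by rewrite -/L -/L' !ler_norml; lra.
have rpos : 0 < lim_right f (x t).
  rewrite lt_neqAle eq_sym r0 leNgt; apply/negP => Lneg.
  by move/eqP: fn0; apply; apply: a2; right.
split=> [|p /andP[xp]]; first exact: xx.
rewrite le_eqVlt => /predU1P[->|px]; first by split.
by have [_] := Aw p (ltW xp) px; apply; rewrite xp lexx.
Qed.

Lemma rising_path_stay s t : 0 <= s -> s <= t -> ~ A (x s) -> x t = x s.
Proof.
move=> s0 st nA; apply/le_anti/andP; split; last exact: rising_path_mono.
rewrite leNgt; apply/negP => xst; apply: nA.
by have [] := rising_path_below (le_trans s0 st) (rising_path_ge s0) xst.
Qed.

Lemma rising_path_right p e : 0 <= p -> 0 < e ->
  exists L, exists2 d, 0 < d & forall q, p < q < p + d ->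
    `|f (x q) - L| <= e /\ `|x q - x p - L * (q - p)| <= e * (q - p).
Proof.
move=> p0 e0; have [Ap|nA] := pselect (A (x p)); last first.
  exists 0, 1 => // q pq; have -> : x q = x p by apply: rising_path_stay => //; lra.
  rewrite rising_path_stop// !subrr mul0r subr0 normr0; split; first exact: ltW.
  by rewrite mulr_ge0//; lra.
have xp := rising_path_ge p0.
have [d [d0 Ad H]] := travel_time_right Ap e0.
have Ad2 : A (x p + d / 2) by apply: (uphill_down Ad); lra.
have pT : p < T (x p + d / 2).
  rewrite -{1}(rising_path_time p0 Ap).
  by apply: (travel_time_lt Ad2) => //; lra.
exists (lim_right f (x p)), (T (x p + d / 2) - p); first lra.
move=> q pq; have q0 : 0 <= q by lra.
have xpq : x p <= x q by apply: rising_path_mono; lra.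
have xqd : x q <= x p + d / 2.
  by rewrite -(rising_pathK Ad2); apply: rising_path_mono; lra.
have Aq : A (x q) by apply: (uphill_down Ad2); lra.
have Tq := rising_path_time q0 Aq; have Tp := rising_path_time p0 Ap.
have xlt : x p < x q.
  by rewrite lt_neqAle xpq andbT; apply/eqP => E; move: Tq; rewrite -E Tp; lra.
by have := H (x q); rewrite Tq Tp; apply; lra.
Qed.

Lemma rising_path_left_uphill p e : 0 < p -> A (x p) -> 0 < e ->
  exists L, exists2 d, 0 < d & forall q, p - d < q < p ->
    `|f (x q) - L| <= e /\ `|x p - x q - L * (p - q)| <= e * (p - q).
Proof.
move=> p0 Ap e0; have xp := rising_path_ge (ltW p0).
have Tp := rising_path_time (ltW p0) Ap.
have xlt : x0 < x p.
  by rewrite lt_neqAle xp andbT; apply/eqP => E; move: Tp; rewrite -E travel_time_start; lra.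
have [d [d0 xd H]] := travel_time_left Ap xlt e0.
have Ad2 : A (x p - d / 2) by apply: (uphill_down Ap); lra.
have T0 := travel_time_ge0 Ad2.
have Tlt : T (x p - d / 2) < p.
  by rewrite -{2}Tp; apply: (travel_time_lt Ap); lra.
exists (lim_left f (x p)), (p - T (x p - d / 2)); first lra.
move=> q pq; have q0 : 0 <= q by lra.
have xqp : x q <= x p by apply: rising_path_mono; lra.
have xqd : x p - d / 2 <= x q.
  by rewrite -(rising_pathK Ad2); apply: rising_path_mono; lra.
have Aq : A (x q) by apply: (uphill_down Ap); lra.
have Tq := rising_path_time q0 Aq.
have xqlt : x q < x p.
  by rewrite lt_neqAle xqp andbT; apply/eqP => E; move: Tq; rewrite E Tp; lra.
by have := H (x q); rewrite Tq Tp; apply; lra.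
Qed.

Lemma rising_path_slopes_uphill a b : 0 <= a -> A (x b) ->
  local_slopes x (f \o x) a b.
Proof.
move=> a0 Ab; split=> p e pab e0; first by apply: rising_path_right => //; lra.
apply: rising_path_left_uphill => //; first lra.
apply: (uphill_down Ab); first by apply: rising_path_ge; lra.
by apply: rising_path_mono; lra.
Qed.

Lemma rising_path_left_stop p e : 0 < p -> ~ A (x p) ->
  (forall q, 0 <= q < p -> A (x q)) -> 0 < e ->
  exists L, exists2 d, 0 < d & forall q, p - d < q < p ->
    `|f (x q) - L| <= e /\ `|x p - x q - L * (p - q)| <= e * (p - q).
Proof.
move=> p0 nA Aq e0; have xp := rising_path_ge (ltW p0).
have xlt : x0 < x p.
  by rewrite lt_neqAle xp andbT; apply/eqP => E; apply: nA; rewrite -E; exact: uphill_start.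
have xqlt q : 0 <= q < p -> x q < x p.
  move=> qp; rewrite lt_neqAle rising_path_mono ?andbT; [|lra|lra].
  by apply/eqP => E; apply: nA; rewrite -E; exact: Aq.
have late m : 0 < m -> exists2 t, 0 <= t < p & forall q, t <= q < p -> x p - m < x q.
  move=> m0; have [k [k0 km kx]] := exists_lower m0 (ltac:(lra) : 0 < x p - x0).
  (* Two points below [x p] are used because the nearer one is only known to be reached no later
     than [p]; strict growth of the travel time makes the farther one reached strictly before. *)
  have [Aw _] := @rising_path_below p (x p - k / 2) (ltW p0) ltac:(lra) ltac:(lra).
  have [Aw' Tw'] := @rising_path_below p (x p - k / 4) (ltW p0) ltac:(lra) ltac:(lra).
  have Tlt := @travel_time_lt _ (x p - k / 2) (x p - k / 4) Aw' ltac:(lra) ltac:(lra) (lexx _).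
  have T0 := travel_time_ge0 Aw.
  exists (T (x p - k / 2)); first lra.
  move=> q qp; apply: (@lt_le_trans _ _ (x p - k / 2)); first lra.
  by rewrite -{1}(rising_pathK Aw); apply: rising_path_mono; lra.
have [d d0 fd] := lim_left_close (x p) rf e0; set L := lim_left f (x p) in fd.
have [t1 t1p xt1] := late d d0.
have fL q : t1 < q < p -> `|f (x q) - L| <= e.
  by move=> qp; apply: fd; rewrite xt1 ?xqlt//; lra.
exists L, (p - t1); first lra.
move=> q qp; split; first by apply: fL; lra.
apply/ler_addgt0Pr => k k0.
have L1 : 0 < `|L| + 1 by have := normr_ge0 L; lra.
(* [m] will bound both [x p - x t] and [p - t], so the total error [m + |L| * m] is at most [k]. *)
have [m [m0 mk mq]] := exists_lower (divr_gt0 k0 L1) (ltac:(lra) : 0 < p - q).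
rewrite ler_pdivlMr// in mk.
have [t2 t2p xt2] := late m m0.
have [t [tq tp t2t mt]] : exists t, [/\ q < t, t < p, t2 <= t & p - m <= t].
  exists (Num.max t2 (p - m / 2)); split; rewrite ?lt_max ?gt_max ?le_max ?lexx//.
  - by apply/orP; right; lra.
  - by apply/andP; split; lra.
  - by apply/orP; right; lra.
have xt : x p - m < x t by apply: xt2; rewrite t2t.
have xt' : x t < x p by apply: xqlt; lra.
have q0 : 0 <= q by lra.
have := local_slopes_increment tq (rising_path_slopes_uphill q0 (Aq t ltac:(lra))).
move=> /(_ (L - e) (L + e)) H.
have {}H : (L - e) * (t - q) <= x t - x q <= (L + e) * (t - q).
  by apply: H => r rq; have := fL r ltac:(lra); rewrite ler_norml /=; lra.
have Lm : - (`|L| * m) <= L * (p - t) <= `|L| * m.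
  rewrite -ler_norml normrM ler_wpM2l// ger0_norm; lra.
have em : 0 <= e * (p - t) by rewrite mulr_ge0//; lra.
by rewrite ler_norml; lra.
Qed.

(** Left slopes at [p] fall into three cases: still uphill at [p], already stopped before [p], or
    stopping exactly at [p]. *)
Lemma rising_path_solution : caratheodory_solution f x0 x.
Proof.
apply: solution_of_local_slopes.
  by have := rising_pathK uphill_start; rewrite travel_time_start.
move=> t t0; split=> p e pt e0; first by apply: rising_path_right => //; lra.
have p0 : 0 < p by lra.
have [Ap|nA] := pselect (A (x p)); first exact: rising_path_left_uphill.
have [[s sp nAs]|Aq] := pselect (exists2 s, 0 <= s < p & ~ A (x s)).
  exists 0, (p - s); first lra.
  have xs q : s <= q -> x q = x s by move=> sq; apply: rising_path_stay => //; lra.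
  move=> q qp; rewrite /= !xs; [|lra|lra].
  rewrite rising_path_stop//; last lra.
  rewrite !subrr mul0r subr0 normr0; split; first exact: ltW.
  by rewrite mulr_ge0//; lra.
apply: rising_path_left_stop => // q qp; apply: contrapT => nAq.
by apply: Aq; exists q.
Qed.

End rising.

(** * Existence for every initial value, and the theorem *)

Lemma solution_exists (R : realType) (f : R -> R) (x0 : R) : A1 f -> A2 f ->
  exists x, caratheodory_solution f x0 x.
Proof.
move=> a1 a2; have [[M fM] rf] := a1.
have M0 : 0 < M + 1 by have := le_trans (normr_ge0 _) (fM 0); lra.
have [f0|fn0] := eqVneq (f x0) 0.
  exists (cst x0); apply: solution_of_local_slopes => // t t0.
  by split=> p e pt e0; exists 0, 1 => // q pq;
    rewrite /= f0 !subrr mul0r subr0 normr0; split; rewrite ?mulr_ge0//; lra.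
have /andP[l0 r0] := field_neq0_limits_neq0 a2 fn0.
have [rpos|rneg] := ltP 0 (lim_right f x0).
  exists (rising_path f x0); apply: (rising_path_solution rf a2 M0) => // y.
  by have := fM y; rewrite ler_norml; lra.
(* A positive left limit with this negative right limit would force [f x0 = 0] by (A2). Hence the
   left limit is negative, and the reflected field rises from [- x0]. *)
have lneg : lim_left f x0 < 0.
  rewrite lt_neqAle l0 leNgt; apply/negP => lpos.
  by move/eqP: fn0; apply; apply: a2; right; split => //; rewrite lt_neqAle r0.
have [_ rf'] := A1_reflect a1.
exists (fun t => - rising_path (reflect_field f) (- x0) t).
suff : caratheodory_solution (reflect_field f) (- x0) (rising_path (reflect_field f) (- x0)).
  by move=> /solution_reflect; rewrite reflect_fieldK opprK.
apply: (rising_path_solution rf' (A2_reflect rf a2) M0).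
  by move=> y; have := fM (- y); rewrite /reflect_field ler_norml; lra.
by rewrite lim_right_reflect// opprK oppr_gt0.
Qed.

Theorem theorem2p1 (R : realType) (f : R -> R) :
  A1 f -> A2 f ->
  (* (i) existence of a global solution *)
  (forall x0 : R, exists x : R -> R, caratheodory_solution f x0 x) /\
  (* (ii) every solution is monotone *)
  (forall (x0 : R) (x : R -> R), caratheodory_solution f x0 x -> monotone_on_nonneg x) /\
  (* (iii) the solution set is nonempty and closed for uniform convergence on
     bounded subsets of [0,+oo[ *)
  (forall x0 : R,
     (exists x : R -> R, caratheodory_solution f x0 x) /\
     (forall (F : set_system (R -> R)) (x : R -> R),
        ProperFilter F ->
        F (caratheodory_solution f x0) ->
        cvg_unif_bounded F x ->
        caratheodory_solution f x0 x)).
Proof.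
move=> a1 a2; split; [|split].
- by move=> x0; exact: solution_exists.
- by move=> x0 x; exact: solution_monotone.
- move=> x0; split; first exact: solution_exists.
  by move=> F x; exact: solutions_closed.
Qed.
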